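(* Let $\mathsf{G}$ be a connected weighted graph on $n\ge 2$ vertices with Laplacian $A$, and let $\bm{\varphi}=(\bm{\varphi}_0,\varphi_n)^T\in\mathbb{R}^n$, $\|\bm{\varphi}\|=1$, be a Fiedler vector of $A$, where $\varphi_n$ is its entry at the vertex $\mathsf{v}_n$. Let $\mathsf{G}_D$ be a graph obtained from $\mathsf{G}$ by disaggregating the single vertex $\mathsf{v}_n$ into $d>1$ vertices, and let $N=n-1+d$ be its number of vertices. Then $$\frac{a(\mathsf{G})}{a(\mathsf{G}_D)}\ \ge\ 1+\frac{(d-1)n}{N}\,\varphi_n^2 .$$
   Context: All graphs are finite, simple, undirected, with positive edge weights $\omega_e$. The Laplacian $A$ of $\mathsf{G}=(V,E,\omega)$ is the symmetric matrix with $\langle A\bm{u},\bm{v}\rangle=\sum_{e=(i,j)\in E}\omega_e(u_i-u_j)(v_i-v_j)$. For a connected graph the eigenvalues are $0=\lambda_1<\lambda_2\le\cdots$; the algebraic connectivity is $a(\mathsf{G})=\lambda_2$, and a Fiedler vector is an eigenvector for $\lambda_2$. $\|\cdot\|$ is the Euclidean norm. Disaggregating the vertex $\mathsf{v}_n$ of $\mathsf{G}$ into $d$ vertices: the new graph $\mathsf{G}_D$ has vertices $1,\dots,n-1$ (the old vertices other than $\mathsf{v}_n$) and $d$ new vertices $n,\dots,N$ with $N=n-1+d$. Edges of $\mathsf{G}$ not incident to $\mathsf{v}_n$ are kept with their weights; each edge $(i,\mathsf{v}_n)$ of $\mathsf{G}$ is replaced by one edge of the same weight joining $i$ to one (arbitrarily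 chosen) new vertex; and an arbitrary connected graph with positive edge weights is placed on the $d$ new vertices. Thus $\mathsf{G}_D$ is connected. *)

(* Defs.v *)
From HB Require Import structures.
From mathcomp Require Import all_boot all_order all_algebra.
From mathcomp Require Import polyrcf.
From mathcomp Require Import reals.
From mathcomp Require Import ring.
Set Implicit Arguments.
Unset Strict Implicit.
Unset Printing Implicit Defensive.
Import Order.TTheory GRing.Theory Num.Theory.
Local Open Scope ring_scope.

(* Only the weights of pairs satisfying [edge] are ever used. *)
Record wgraph (R : rcfType) (n : nat) := WGraph {
  edge : rel 'I_n;
  weight : 'I_n -> 'I_n -> R;
  edge_sym : symmetric edge;
  edge_irr : irreflexive edge;
  weight_sym : forall i j, weight i j = weight j i;
  weight_gt0 : forall i j, edge i j -> 0 < weight i j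
}.

Definition graph_connected (R : rcfType) (n : nat) (G : wgraph R n) : Prop :=
  forall i j, connect (edge G) i j.

(* Each undirected edge {i, j} is counted once, as the pair with i < j. *)
Definition lap_form (R : rcfType) (n : nat) (G : wgraph R n)
    (u v : 'cV[R]_n) : R :=
  \sum_(e : 'I_n * 'I_n | (e.1 < e.2)%N && edge G e.1 e.2)
    weight G e.1 e.2 * (u e.1 0 - u e.2 0) * (v e.1 0 - v e.2 0).

(* The matrix of [lap_form] in the standard basis; see [laplacianE]. *)
Definition laplacian (R : rcfType) (n : nat) (G : wgraph R n) : 'M[R]_n :=
  \matrix_(i, j) lap_form G (delta_mx j 0) (delta_mx i 0).

Lemma laplacian_sym (R : rcfType) (n : nat) (G : wgraph R n) :
  (laplacian G)^T = laplacian G.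
Proof.
by apply/matrixP => i j; rewrite !mxE; apply: eq_bigr => e _; rewrite mulrAC.
Qed.

Lemma laplacianE (R : rcfType) (n : nat) (G : wgraph R n) (u v : 'cV[R]_n) :
  \sum_i (laplacian G *m u) i 0 * v i 0 = lap_form G u v.
Proof.
have expand (w : 'cV[R]_n) p q : w p 0 - w q 0 =
    \sum_k w k 0 * ((delta_mx k 0 : 'cV[R]_n) p 0 - (delta_mx k 0 : 'cV[R]_n) q 0).
  have E r : w r 0 = \sum_k w k 0 * (delta_mx k 0 : 'cV[R]_n) r 0.
    rewrite (bigD1 r) //= mxE !eqxx mulr1 big1 ?addr0 // => k kr.
    by rewrite mxE eq_sym (negbTE kr) mulr0.
  by rewrite {1}(E p) {1}(E q) -sumrB; apply: eq_bigr => k _; rewrite mulrBr.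
under eq_bigr => i _ do rewrite mxE mulr_suml.
under eq_bigr => i _ do under eq_bigr => j _ do
  rewrite [laplacian G i j]mxE /lap_form 2!mulr_suml.
under eq_bigr => i _ do rewrite exchange_big /=.
rewrite exchange_big /=; apply: eq_bigr => e _.
rewrite [v e.1 0 - v e.2 0]expand [RHS]mulr_sumr; apply: eq_bigr => i _.
rewrite [u e.1 0 - u e.2 0]expand mulr_sumr mulr_suml.
by apply: eq_bigr => j _; ring.
Qed.

(* The real eigenvalues, listed in nondecreasing order and repeated according
   to their algebraic multiplicity; see [spectrumE]. *)
Definition spectrum (R : rcfType) (n : nat) (A : 'M[R]_n) : seq R :=
  flatten [seq nseq (mup x (char_poly A)) x | x <- rootsR (char_poly A)].

Lemma spectrumE (R : rcfType) (n : nat) (A : 'M[R]_n) (s : seq R) :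
  sorted <=%R s -> char_poly A = \prod_(x <- s) ('X - x%:P) -> spectrum A = s.
Proof.
move=> s_sorted pE.
have p0 : char_poly A != 0 by rewrite monic_neq0 ?char_poly_monic.
have mupE x : mup x (char_poly A) = count_mem x s by rewrite pE mu_prod_XsubC.
apply: (sorted_eq le_trans le_anti) => //.
  rewrite /spectrum; have := sorted_roots (- cauchy_bound (char_poly A))
    (cauchy_bound (char_poly A)) (char_poly A).
  rewrite -/(rootsR _) lt_sorted_pairwise le_sorted_pairwise.
  elim: (rootsR _) => //= x r IH /andP[xr /IH rr].
  rewrite pairwise_cat rr andbT; apply/andP; split.
    apply/allrelP => y z /nseqP[-> _] /flatten_mapP[t tr /nseqP[-> _]].
    by rewrite ltW // (allP xr).
  by apply/(pairwiseP 0) => i j; rewrite !inE size_nseq !nth_nseq => -> ->.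
apply/allP => x _ /=; rewrite -mupE count_flatten -map_comp /=.
rewrite sumnE big_map (eq_bigr (fun y => (y == x) * mup y (char_poly A))%N); last first.
  by move=> y _; rewrite /= count_nseq.
have [xr|xNr] := boolP (x \in rootsR (char_poly A)).
  rewrite (bigD1_seq x) ?uniq_roots //= eqxx mul1n big1 ?addn0 // => y.
  by move=> /negbTE ->.
rewrite mupNroot; last first.
  by apply: contra xNr => xr; rewrite -(roots_on_rootsR p0) inE.
rewrite big_seq big1 // => y yr.
by case: eqP yr xNr => // -> ->.
Qed.

(* lambda_2, the second entry when counting from lambda_1. *)
Definition alg_connectivity (R : rcfType) (n : nat) (G : wgraph R n) : R :=
  (spectrum (laplacian G))`_1.

Definition fiedler_vector (R : rcfType) (n : nat) (G : wgraph R n)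
    (phi : 'cV[R]_n) : Prop :=
  phi != 0 /\ laplacian G *m phi = alg_connectivity G *: phi.

Definition enorm (R : rcfType) (n : nat) (u : 'cV[R]_n) : R :=
  Num.sqrt (\sum_i u i 0 ^+ 2).

Section Disaggregation.
Variables (R : rcfType) (n d : nat) (G : wgraph R n) (v : 'I_n).
Variables (s : 'I_n.-1 -> 'I_d) (H : wgraph R d).

(* [lift v] enumerates the vertices of G other than v. *)
Definition disagg_edge : rel 'I_(n.-1 + d) := fun x y =>
  match split x, split y with
  | inl i, inl j => edge G (lift v i) (lift v j)
  | inl i, inr k | inr k, inl i => edge G (lift v i) v && (s i == k)
  | inr k, inr l => edge H k l
  end.

Definition disagg_weight (x y : 'I_(n.-1 + d)) : R :=
  match split x, split y with
  | inl i, inl j => weight G (lift v i) (lift v j)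
  | inl i, inr _ | inr _, inl i => weight G (lift v i) v
  | inr k, inr l => weight H k l
  end.

Lemma disagg_edge_sym : symmetric disagg_edge.
Proof.
move=> x y; rewrite /disagg_edge.
by case: (split x) => i; case: (split y) => j //; rewrite edge_sym.
Qed.

Lemma disagg_edge_irr : irreflexive disagg_edge.
Proof. by move=> x; rewrite /disagg_edge; case: (split x) => i; rewrite edge_irr. Qed.

Lemma disagg_weight_sym x y : disagg_weight x y = disagg_weight y x.
Proof.
rewrite /disagg_weight.
by case: (split x) => i; case: (split y) => j //; rewrite weight_sym.
Qed.

Lemma disagg_weight_gt0 x y : disagg_edge x y -> 0 < disagg_weight x y.
Proof.
rewrite /disagg_edge /disagg_weight.
case: (split x) => i; case: (split y) => j; try by move=> /weight_gt0.
  by case/andP=> /weight_gt0.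
by case/andP=> /weight_gt0.
Qed.

(* The vertices of G other than v come first, followed by the d new vertices,
   on which H is placed; the edge of G joining [lift v i] to v, if there is one,
   is reattached to the new vertex [s i]. *)
Definition disaggregate : wgraph R (n.-1 + d) :=
  WGraph disagg_edge_sym disagg_edge_irr disagg_weight_sym disagg_weight_gt0.

End Disaggregation.

(* Main.v *)
(* Extend phi to GD by giving each of the d new vertices the value phi_n, and
   subtract the mean.  No edge between new vertices contributes to the Laplacian
   form of the resulting vector, so this form still equals a(G), while the
   squared norm is 1 + (d - 1) phi_n^2 - N m^2 with mean m = (d - 1) phi_n / N,
   that is 1 + (d - 1) n phi_n^2 / N.  The Rayleigh bound for the second
   eigenvalue on the orthogonal complement of the constants concludes. *)

Require Import Defs.
From mathcomp Require Import all_boot all_order all_algebra reals.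
From mathcomp Require Import spectral complex ring.
Set Implicit Arguments.
Unset Strict Implicit.
Unset Printing Implicit Defensive.
Import Order.TTheory GRing.Theory Num.Theory.
Local Open Scope ring_scope.
Local Open Scope sesquilinear_scope.

(** * Spectral theorem for real symmetric matrices and the second eigenvalue *)

Local Notation toC R := (map_mx (real_complex R)).

Lemma conjC_toC (R : rcfType) m n (A : 'M[R]_(m, n)) :
  map_mx Num.conj (toC R A) = toC R A.
Proof.
apply/matrixP => i j; rewrite !mxE; apply: CrealP.
by rewrite complex_real.
Qed.

(** Over [R[i]] the matrix is Hermitian, hence unitarily diagonalizable with real eigenvalues. Only
    the diagonal is brought back to [R]; the eigenbasis [P] stays complex. *)
Lemma symmetric_spectral (R : rcfType) n (A : 'M[R]_n) : A^T = A ->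
  exists (P : 'M[R[i]]_n) (r : 'rV[R]_n), P \is unitarymx /\
    toC R A = P^t* *m diag_mx (toC R r) *m P.
Proof.
move=> Asym; set AC := toC R A.
have ACh : AC \is hermsymmx.
  apply/is_hermitianmxP.
  by rewrite expr0 scale1r /AC map_trmx Asym conjC_toC.
exists (spectralmx AC), (map_mx (@complex.Re R) (spectral_diag AC)).
split; first exact: spectral_unitarymx.
have /orthomx_spectralP {1}-> := hermitian_normalmx ACh.
rewrite invmx_unitary ?spectral_unitarymx //; congr (_ *m diag_mx _ *m _).
apply/matrixP => i j; rewrite !mxE RRe_real //.
exact/mxOverP/hermitian_spectral_diag_real.
Qed.

Lemma char_poly_similar (R : comNzRingType) n (A B P Q : 'M[R]_n) :
  Q *m P = 1%:M -> A = P *m B *m Q -> char_poly A = char_poly B.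
Proof.
move=> QP ->; have PQ : P *m Q = 1%:M by apply: mulmx1C.
rewrite /char_poly.
have -> : char_poly_mx (P *m B *m Q) =
    map_mx polyC P *m char_poly_mx B *m map_mx polyC Q.
  rewrite /char_poly_mx !map_mxM mulmxBr mulmxBl; congr (_ - _).
  by rewrite scalar_mxC -mulmxA -map_mxM PQ map_mx1 mulmx1.
by rewrite !det_mulmx mulrAC -det_mulmx -map_mxM PQ map_mx1 det1 mul1r.
Qed.

Lemma char_poly_diag (R : comNzRingType) n (d : 'rV[R]_n) :
  char_poly (diag_mx d) = \prod_i ('X - (d 0 i)%:P).
Proof.
rewrite char_poly_trig ?diag_mx_is_trig //.
by apply: eq_bigr => i _; rewrite mxE eqxx mulr1n.
Qed.

Section SpectralDecomposition.
Variables (R : rcfType) (n : nat) (A : 'M[R]_n).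
Variables (P : 'M[R[i]]_n) (r : 'rV[R]_n).
Hypothesis P_unitary : P \is unitarymx.
Hypothesis AE : toC R A = P^t* *m diag_mx (toC R r) *m P.

Let PPt : P *m P^t* = 1%:M. Proof. exact/unitarymxP. Qed.
Let PtP : P^t* *m P = 1%:M. Proof. exact: mulmx1C. Qed.

Lemma spectral_char_poly : char_poly A = \prod_i ('X - (r 0 i)%:P).
Proof.
apply: (@map_poly_inj _ _ (real_complex R)).
rewrite map_char_poly (char_poly_similar PPt AE) char_poly_diag.
rewrite rmorph_prod; apply: eq_bigr => i _.
by rewrite !mxE rmorphB /= map_polyX map_polyC.
Qed.

Lemma spectral_eigenvalue i : eigenvalue A (r 0 i).
Proof.
rewrite eigenvalue_root_char spectral_char_poly rootE horner_prod.
by rewrite (bigD1 i) //= !hornerE subrr mul0r.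
Qed.

Lemma spectral_row i :
  row i P *m toC R A = (r 0 i)%:C%C *: row i P.
Proof.
by rewrite AE !mulmxA -row_mul PPt row1 -rowE row_diag_mx -scalemxAl -rowE mxE.
Qed.

(** Parseval's identity: the entries of [toC R u *m P^t*] are the coordinates of [u] in the
    orthonormal basis formed by the rows of [P]. *)
Lemma spectral_norm (u : 'rV[R]_n) :
  (((u *m u^T) 0 0)%:C)%C = \sum_i `|(toC R u *m P^t*) 0 i| ^+ 2.
Proof.
have -> : ((u *m u^T) 0 0)%:C%C = (toC R (u *m u^T)) 0 0 by rewrite [RHS]mxE.
rewrite map_mxM -[toC R u in LHS]mulmx1 -PtP mulmxA -mulmxA mxE.
apply: eq_bigr => i _; rewrite normCK; congr (_ * _).
(* As [u] is real, the entries of $P u^T$ are the conjugates of the entries of $u P^*$. *)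
rewrite -conjC_toC !mxE rmorph_sum; apply: eq_bigr => k _.
by rewrite rmorphM !mxE /= !conjCK mulrC.
Qed.

Lemma spectral_form (u : 'rV[R]_n) :
  (((u *m A *m u^T) 0 0)%:C)%C =
  \sum_i (r 0 i)%:C%C * `|(toC R u *m P^t*) 0 i| ^+ 2.
Proof.
have -> : ((u *m A *m u^T) 0 0)%:C%C = (toC R (u *m A *m u^T)) 0 0 by rewrite [RHS]mxE.
rewrite !map_mxM AE !mulmxA -mulmxA mxE.
apply: eq_bigr => i _; rewrite normCK mulrCA mul_mx_diag mxE -mulrA.
congr (_ * _); rewrite [toC R r 0 i]mxE; congr (_ * _).
rewrite -conjC_toC !mxE rmorph_sum; apply: eq_bigr => k _.
by rewrite rmorphM !mxE /= !conjCK mulrC.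
Qed.

End SpectralDecomposition.

Lemma mulmx_tr_ge0 (R : realDomainType) n (u : 'rV[R]_n) : 0 <= (u *m u^T) 0 0.
Proof. by rewrite mxE sumr_ge0 // => i _; rewrite !mxE -expr2 sqr_ge0. Qed.

Lemma mulmx_tr_gt0 (R : realDomainType) n (u : 'rV[R]_n) :
  u != 0 -> 0 < (u *m u^T) 0 0.
Proof.
move=> u0; rewrite lt0r mulmx_tr_ge0 andbT; apply: contra u0.
rewrite mxE psumr_eq0 => [/allP u0|i _]; last by rewrite !mxE -expr2 sqr_ge0.
apply/eqP/rowP => i; have := u0 i (mem_index_enum i).
by rewrite !mxE mulf_eq0 orbb => /eqP.
Qed.

(** The kernel is a line, so 0 is a simple eigenvalue and index 1 of the spectrum holds the least of
    the others. A vector orthogonal to [e] has no coordinate along the kernel, and every other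
    squared coordinate is weighted in the form by at least that eigenvalue. *)
Lemma second_eigenvalue_rayleigh (R : rcfType) n (A : 'M[R]_n) (e : 'rV[R]_n) :
    (1 < n)%N -> A^T = A -> (forall x : 'rV_n, 0 <= (x *m A *m x^T) 0 0) ->
    e != 0 -> (kermx A :=: e)%MS ->
  0 < (spectrum A)`_1 /\ forall u : 'rV_n, u *m e^T = 0 ->
    (spectrum A)`_1 * (u *m u^T) 0 0 <= (u *m A *m u^T) 0 0.
Proof.
move=> n_gt1 /symmetric_spectral[P [r [Pu AE]]] Apos e0 kerA.
have charA := spectral_char_poly Pu AE.
have r_ge0 i : 0 <= r 0 i.
  have /eigenvalueP[x xA x0] := spectral_eigenvalue Pu AE i.
  have := Apos x; rewrite xA -scalemxAl mxE pmulr_lge0 //.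
  exact: mulmx_tr_gt0.
have [i0 ri0] : exists i, r 0 i = 0.
  have : eigenvalue A 0.
    apply/eigenvalueP; exists e => //; rewrite scale0r; apply: sub_kermxP.
    by rewrite kerA.
  rewrite eigenvalue_root_char charA rootE horner_prod => /prodf_eq0[i _].
  by rewrite !hornerE oppr_eq0 => /eqP ri; exists i.
have rowE i : r 0 i = 0 -> exists c, row i P = c *: toC R e.
  move=> ri; apply/sub_rVP.
  have : (row i P <= kermx (toC R A))%MS.
    by apply/sub_kermxP; rewrite (spectral_row Pu AE) ri scale0r.
  by move/submx_trans; apply; rewrite -map_kermx map_submx kerA.
have dotP i j : (row i P *m (row j P)^t*) 0 0 = (i == j)%:R.
  have -> : (row i P *m (row j P)^t*) 0 0 = (P *m P^t*) i j.
    by rewrite !mxE; apply: eq_bigr => k _; rewrite !mxE.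
  by rewrite (unitarymxP Pu) mxE.
have eeE : toC R e *m (toC R e)^t* = toC R (e *m e^T).
  by rewrite -map_trmx conjC_toC map_trmx -map_mxM.
(* A second zero eigenvalue would make two distinct rows of [P] multiples of [e]; orthogonality then
   forces one of the factors, or [e] itself, to vanish. *)
have r_gt0 i : i != i0 -> 0 < r 0 i.
  move=> ii0; rewrite lt0r r_ge0 andbT; apply: contra ii0 => /eqP ri.
  have [c ci] := rowE _ ri; have [c' ci0] := rowE _ ri0.
  apply: contraT => /negbTE ii0.
  have := dotP i i0; rewrite ii0 ci ci0 linearZ /= map_mxZ /= -scalemxAr.
  rewrite -scalemxAl eeE => /eqP.
  rewrite mxE mulf_eq0 conjC_eq0 mxE mulf_eq0 [toC R _ 0 0]mxE => /or3P[] /eqP c0.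
  - by have /eqP := dotP i0 i0; rewrite ci0 c0 scale0r mul0mx mxE eqxx eq_sym oner_eq0.
  - by have /eqP := dotP i i; rewrite ci c0 scale0r mul0mx mxE eqxx eq_sym oner_eq0.
  - by have := mulmx_tr_gt0 e0; move: c0 => /complexI ->; rewrite ltxx.
pose t := [seq r 0 i | i <- enum (predC1 i0)].
have spA : spectrum A = 0 :: sort <=%R t.
  apply: spectrumE.
    rewrite /= path_min_sorted ?sort_le_sorted // all_sort.
    by apply/allP => _ /mapP[i _ ->].
  rewrite charA (bigD1 i0) //= big_cons ri0; congr (_ * _).
  by rewrite (perm_big _ (permEl (perm_sort _ _))) big_map big_enum.
rewrite spA /=.
have : sorted <=%R (sort <=%R t) by exact: sort_le_sorted.
have : sort <=%R t =i t by apply: mem_sort.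
(* Since [n] exceeds 1, index 1 of the spectrum is a genuine entry and not the default 0. *)
have : (0 < size (sort <=%R t))%N.
  by rewrite size_sort size_map -cardE cardC1 card_ord -subn1 subn_gt0.
case: (sort _ t) => //= lam l _ memt /(order_path_min le_trans)/allP lam_min.
have lam_le i : i != i0 -> lam <= r 0 i.
  move=> ii0; have : r 0 i \in t by rewrite map_f // mem_enum.
  by rewrite -memt inE => /predU1P[->//|/lam_min].
split=> [|u ue].
  have : lam \in t by rewrite -memt mem_head.
  by case/mapP => i; rewrite mem_enum => ii0 ->; apply: r_gt0.
have [c ci0] := rowE _ ri0.
(* Row [i0] of [P] is a multiple of [e], to which [u] is orthogonal. *)
have u_i0 : (toC R u *m P^t*) 0 i0 = 0.
  have -> : (toC R u *m P^t*) 0 i0 = (toC R u *m (row i0 P)^t*) 0 0.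
    by rewrite !mxE; apply: eq_bigr => k _; rewrite !mxE.
  rewrite ci0 linearZ /= map_mxZ /= -map_trmx conjC_toC -scalemxAr.
  by rewrite map_trmx -map_mxM ue map_mx0 scaler0 mxE.
rewrite -lecR rmorphM /= (spectral_norm Pu) (spectral_form AE) mulr_sumr.
apply: ler_sum => i _; have [->|ii0] := eqVneq i i0.
  by rewrite u_i0 normr0 expr0n !mulr0.
by rewrite ler_wpM2r ?exprn_ge0 // lecR lam_le.
Qed.

(** * The Laplacian form and the Rayleigh bound for connected graphs *)

Lemma connect_invariant (T : finType) (e : rel T) (U : Type) (f : T -> U) :
  (forall i j, e i j -> f i = f j) -> forall i j, connect e i j -> f i = f j.
Proof.
move=> fe i j /connectP[p ep ->]; elim: p i ep => //= k p IH i /andP[ik kp].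
by rewrite (fe _ _ ik) IH.
Qed.

Section Laplacian.
Variables (R : rcfType) (n : nat) (G : wgraph R n).
Implicit Types u v : 'cV[R]_n.

Lemma lap_formE u v :
  (u^T *m laplacian G *m v) 0 0 = lap_form G u v.
Proof.
rewrite -laplacianE -[in LHS]laplacian_sym -trmx_mul mxE.
by apply: eq_bigr => i _; rewrite mxE.
Qed.

Lemma lap_form_ge0 u : 0 <= lap_form G u u.
Proof.
apply: sumr_ge0 => e /andP[_ ee].
by rewrite -mulrA -expr2 mulr_ge0 ?sqr_ge0 ?ltW ?weight_gt0.
Qed.

(** Ordered pairs count each edge twice. This form is free of the condition [i < j], which depends
    on the numbering of the vertices and is not preserved by disaggregation. *)
Lemma lap_form_double u :
  lap_form G u u *+ 2 = \sum_i \sum_(j | edge G i j)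
    weight G i j * (u i 0 - u j 0) ^+ 2.
Proof.
rewrite pair_big_dep /=.
rewrite (bigID (fun p : 'I_n * 'I_n => (p.1 < p.2)%N)) /= mulr2n.
congr (_ + _).
  by apply: eq_big => [e|e _]; [rewrite andbC | rewrite -mulrA -expr2].
(* Swapping the endpoints turns the remaining pairs into those with [i <= j]; the diagonal drops out
   because [edge] is irreflexive. *)
rewrite [RHS](reindex_inj (h := fun p : 'I_n * 'I_n => (p.2, p.1))) /=; last first.
  by move=> [a b] [c d] [-> ->].
apply: eq_big => [[i j]|[i j] _] /=; last by rewrite weight_sym -mulrA -expr2 -opprB sqrrN.
rewrite andbC edge_sym -leqNgt ltn_neqAle val_eqE.
by have [->|ij] := eqVneq i j; rewrite ?edge_irr.
Qed.

Lemma lap_form_eq0 u : lap_form G u u = 0 ->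
  forall i j, edge G i j -> u i 0 = u j 0.
Proof.
move=> u0 i j ij; apply/eqP; rewrite -subr_eq0 -sqrf_eq0.
have : \sum_i \sum_(j | edge G i j)
    weight G i j * (u i 0 - u j 0) ^+ 2 = 0 by rewrite -lap_form_double u0 mul0rn.
have pos a b : edge G a b -> 0 <= weight G a b * (u a 0 - u b 0) ^+ 2.
  by move=> ab; rewrite mulr_ge0 ?sqr_ge0 ?ltW ?weight_gt0.
move/psumr_eq0P => /(_ (fun i _ => sumr_ge0 _ (pos i)))/(_ i isT).
move/psumr_eq0P => /(_ (pos i))/(_ j ij)/eqP.
by rewrite mulf_eq0 gt_eqF ?weight_gt0.
Qed.

Lemma lap_form_shift u v c :
  lap_form G (u + const_mx c) v = lap_form G u v.
Proof. by apply: eq_bigr => e _; rewrite !mxE; congr (_ * _ * _); ring. Qed.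

Lemma lap_form_const u c : lap_form G u (const_mx c) = 0.
Proof. by apply: big1 => e _; rewrite !mxE subrr mulr0. Qed.

Lemma lap_formC u v : lap_form G u v = lap_form G v u.
Proof. by apply: eq_bigr => e _; rewrite mulrAC. Qed.

Lemma mulmx_laplacian_const c : const_mx c *m laplacian G = 0 :> 'rV_n.
Proof.
apply/rowP => j; have colj (M : 'rV[R]_n) : M 0 j = (M *m (delta_mx j 0 : 'cV_n)) 0 0.
  by rewrite -colE mxE.
by rewrite !colj -[const_mx c]trmxK trmx_const lap_formE lap_formC lap_form_const mul0mx mxE.
Qed.


Lemma alg_connectivity_rayleigh : (1 < n)%N -> graph_connected G ->
  0 < alg_connectivity G /\ forall u, \sum_i u i 0 = 0 ->
    alg_connectivity G * \sum_i u i 0 ^+ 2 <= lap_form G u u.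
Proof.
move=> n_gt1 Gc; pose e : 'rV[R]_n := const_mx 1.
have formE (x : 'rV_n) : (x *m laplacian G *m x^T) 0 0 = lap_form G x^T x^T.
  by rewrite -lap_formE trmxK.
have e0 : e != 0.
  apply/eqP => /rowP/(_ (Ordinal (ltnW n_gt1))); rewrite !mxE => /eqP.
  by rewrite oner_eq0.
have kerL : (kermx (laplacian G) :=: e)%MS.
  apply/eqmxP/andP; split; last first.
    by apply/sub_kermxP; exact: mulmx_laplacian_const.
  (* A kernel vector has zero form, hence equal values across each edge, and connectedness makes it
     constant. *)
  apply/row_subP => k; set x := row k _.
  have xL : x *m laplacian G = 0 by apply/sub_kermxP; apply: row_sub.
  have := formE x; rewrite xL mul0mx mxE => /esym/lap_form_eq0 xe.
  pose i := Ordinal (ltnW n_gt1); apply/sub_rVP; exists (x 0 i).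
  apply/rowP => j; rewrite [RHS]mxE [e 0 j]mxE mulr1.
  apply: (connect_invariant _ (Gc j i)) => a b /xe; by rewrite !(mxE trmx_key).
have [] := second_eigenvalue_rayleigh n_gt1 (laplacian_sym G) _ e0 kerL.
  by move=> x; rewrite formE lap_form_ge0.
rewrite -/(alg_connectivity G) => pos min; split=> // u u0.
have := min u^T; rewrite formE trmxK !mxE.
under [X in _ * X]eq_bigr => i _ do rewrite mxE -expr2.
apply; apply/matrixP => i j; rewrite !ord1 !mxE -[RHS]u0.
by apply: eq_bigr => k _; rewrite !mxE mulr1.
Qed.

End Laplacian.

(** Test the hypothesis on the indicator of the component of [i]. With this criterion no path has to
    be built in the disaggregated graph. *)
Lemma connectedP (R : rcfType) n (G : wgraph R n) :
  (forall f : 'I_n -> bool, (forall i j, edge G i j -> f i = f j) ->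
    forall i j, f i = f j) -> graph_connected G.
Proof.
move=> Gf i j; rewrite -(Gf (connect (edge G) i) _ i) ?connect0 // => a b ab.
exact: (same_connect_r (sym_connect_sym (edge_sym G)) (connect1 ab) i).
Qed.

(** * Disaggregation: connectedness and invariance of the form *)

Section Disaggregate.
Variables (R : rcfType) (n d : nat) (G : wgraph R n) (v : 'I_n).
Variables (s : 'I_n.-1 -> 'I_d) (H : wgraph R d).
Let GD := disaggregate G v s H.

Let splitl i : split (lshift d i) = inl i :> 'I_n.-1 + 'I_d.
Proof. exact: (unsplitK (inl i)). Qed.
Let splitr k : split (rshift n.-1 k) = inr k :> 'I_n.-1 + 'I_d.
Proof. exact: (unsplitK (inr k)). Qed.

(** A labelling that agrees across edges takes a single value [c] on the new vertices, as [H] is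
    connected. Giving [v] the label [c] turns it into such a labelling of [G], which is constant
    because [G] is connected. *)
Lemma disaggregate_connected :
  (0 < d)%N -> graph_connected G -> graph_connected H -> graph_connected GD.
Proof.
move=> d_gt0 Gc Hc; apply: connectedP => f fE.
have edgeE x y : edge GD x y = disagg_edge G v s H x y by [].
pose k0 := Ordinal d_gt0; pose c := f (rshift n.-1 k0).
have fr k : f (rshift n.-1 k) = c.
  apply: (connect_invariant (f := fun l => f (rshift n.-1 l)) _ (Hc k k0)).
  move=> a b ab; by apply: fE; rewrite edgeE /disagg_edge !splitr.
pose g i := if unlift v i is Some j then f (lshift d j) else c.
have gE i j : g i = g j.
  apply: (connect_invariant _ (Gc i j)) => {i j} a b; rewrite /g.
  case: unliftP => [i ->|->]; case: unliftP => [j ->|->] // ab.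
  - by apply: fE; rewrite edgeE /disagg_edge !splitl.
  - by rewrite -(fr (s i)); apply: fE; rewrite edgeE /disagg_edge splitl splitr ab eqxx.
  - rewrite -(fr (s j)); apply: fE.
    by rewrite edgeE /disagg_edge splitl splitr edge_sym ab eqxx.
have fc x : f x = c.
  rewrite -[x]splitK; case: (split x) => [i|k] /=; last exact: fr.
  by have := gE (lift v i) v; rewrite /g liftK unlift_none.
by move=> x y; rewrite !fc.
Qed.

Definition disagg_vector (u : 'cV[R]_n) : 'cV[R]_(n.-1 + d) :=
  \col_x match split x with inl i => u (lift v i) 0 | inr _ => u v 0 end.

Lemma disagg_vectorl u i : disagg_vector u (lshift d i) 0 = u (lift v i) 0.
Proof. by rewrite mxE splitl. Qed.

Lemma disagg_vectorr u k : disagg_vector u (rshift n.-1 k) 0 = u v 0.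
Proof. by rewrite mxE splitr. Qed.

(** The value at [v] is taken [d] times instead of once. A general [f] serves both the sum of the
    entries and the sum of their squares. *)
Lemma sum_disagg_vector u (f : R -> R) :
  \sum_x f (disagg_vector u x 0) = \sum_i f (u i 0) + (d%:R - 1) * f (u v 0).
Proof.
rewrite big_split_ord /= [in RHS](bigD1_ord v) //=.
under eq_bigr do rewrite disagg_vectorl.
under [X in _ + X]eq_bigr do rewrite disagg_vectorr.
by rewrite sumr_const card_ord -mulr_natl; ring.
Qed.

(** Edges of [H] join equal values, and each edge from [lift v i] to [v] becomes exactly one edge,
    to [s i], with the same weight and the same end values. *)
Lemma lap_form_disagg_vector u :
  lap_form GD (disagg_vector u) (disagg_vector u) = lap_form G u u.
Proof.
suff E2 : lap_form GD (disagg_vector u) (disagg_vector u) *+ 2 = lap_form G u u *+ 2.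
  by apply/eqP; move/eqP: E2; rewrite eqrMn2r.
rewrite !lap_form_double big_split_ord /=.
rewrite [in RHS](bigD1_ord v) //= addrC; congr (_ + _); last first.
  (* Pairs starting at an old vertex: the sum over new neighbours collapses to [s i] and matches the
     term of [v] in [G]. *)
  apply: eq_bigr => i _; rewrite big_split_ord /= addrC.
  rewrite [RHS]big_mkcond [in RHS](bigD1_ord v) //= -big_mkcond /=; congr (_ + _).
    under eq_bigr => k _ do
      rewrite disagg_vectorl disagg_vectorr /disagg_weight splitl splitr.
    under eq_bigl => k do rewrite /disagg_edge splitl splitr.
    case: (edge G _ v) => /=; last by rewrite big_pred0.
    by rewrite (big_pred1 (s i)) // => k; rewrite /= eq_sym.
  apply: eq_big => [j|j _]; first by rewrite /disagg_edge !splitl.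
  by rewrite !disagg_vectorl /disagg_weight !splitl.
(* Pairs starting at a new vertex: those within [H] contribute nothing. *)
under eq_bigr => k _.
  rewrite big_split_ord /= [X in _ + X]big1 ?addr0.
    over.
  by move=> l _; rewrite !disagg_vectorr subrr expr0n mulr0.
(* With the old vertex outermost, the sum over new vertices again collapses to [s i]. *)
rewrite (exchange_big_dep predT) //= [RHS]big_mkcond [in RHS](bigD1_ord v) //=.
rewrite edge_irr add0r; apply: eq_bigr => i _.
under eq_bigr => k _ do
  rewrite disagg_vectorl disagg_vectorr /disagg_weight splitl splitr.
under eq_bigl => k do rewrite /disagg_edge splitl splitr.
rewrite edge_sym weight_sym; case: (edge G v _) => /=; last by rewrite big_pred0.
by rewrite (big_pred1 (s i)) // => k; rewrite /= eq_sym.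
Qed.

End Disaggregate.

(** * The eigenvalue inequality *)

Theorem theorem1 (R : realType) (n d : nat) (n_ge2 : (2 <= n)%N)
    (d_gt1 : (1 < d)%N) (G : wgraph R n) (G_conn : graph_connected G)
    (phi : 'cV[R]_n) (phi_norm : enorm phi = 1)
    (phi_fiedler : fiedler_vector G phi) (v : 'I_n)
    (s : 'I_n.-1 -> 'I_d) (H : wgraph R d) (H_conn : graph_connected H) :
  let GD := disaggregate G v s H in
  let N := (n.-1 + d)%N in
  alg_connectivity G / alg_connectivity GD
    >= 1 + (d%:R - 1) * n%:R / N%:R * phi v 0 ^+ 2.
Proof.
cbv zeta; set GD := disaggregate G v s H; set N := (n.-1 + d)%N.
have N_gt1 : (1 < N)%N by rewrite (leq_trans d_gt1) ?leq_addl.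
have N_neq0 : N%:R != 0 :> R by rewrite pnatr_eq0 -lt0n ltnW.
have NE : N%:R = n%:R - 1 + d%:R :> R.
  by rewrite /N natrD -subn1 natrB // ltnW.
have [aG_gt0 _] := alg_connectivity_rayleigh n_ge2 G_conn.
have [|aGD_gt0 aGD_min] := alg_connectivity_rayleigh (G := GD) N_gt1.
  by apply: disaggregate_connected => //; apply: ltnW.
have [_ phi_eigen] := phi_fiedler.
have phi_sum2 : \sum_i phi i 0 ^+ 2 = 1.
  have S0 : 0 <= \sum_i phi i 0 ^+ 2 by apply: sumr_ge0 => i _; apply: sqr_ge0.
  by rewrite -(sqr_sqrtr S0) -/(enorm phi) phi_norm expr1n.
have form_phi w : lap_form G phi w = alg_connectivity G * \sum_i phi i 0 * w i 0.
  rewrite -laplacianE phi_eigen mulr_sumr.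
  by apply: eq_bigr => i _; rewrite mxE mulrA.
(* Pairing the eigenvector equation with the constant vector gives $a(G)\sum_i\varphi_i = 0$, and
   $a(G) > 0$. *)
have phi_sum : \sum_i phi i 0 = 0.
  have /esym/eqP := form_phi (const_mx 1); rewrite lap_form_const.
  rewrite mulf_eq0 gt_eqF //= => /eqP sum0; rewrite -[RHS]sum0.
  by apply: eq_bigr => i _; rewrite mxE mulr1.
set p := phi v 0; pose m := (d%:R - 1) * p / N%:R.
pose w := disagg_vector d v phi.
have w_sum : \sum_x w x 0 = (d%:R - 1) * p.
  by rewrite (sum_disagg_vector d v phi id) phi_sum add0r.
have w_sum2 : \sum_x w x 0 ^+ 2 = 1 + (d%:R - 1) * p ^+ 2.
  by rewrite (sum_disagg_vector d v phi (fun x => x ^+ 2)) phi_sum2.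
have := aGD_min (w + const_mx (- m)).
rewrite lap_form_shift lap_formC lap_form_shift lap_form_disagg_vector.
rewrite form_phi.
under [\sum_i phi i 0 * _]eq_bigr do rewrite -expr2.
rewrite phi_sum2 mulr1.
have wE x : (w + const_mx (- m)) x 0 = w x 0 - m.
  by rewrite mxE [const_mx _ _ _]mxE.
have -> : \sum_x (w + const_mx (- m)) x 0 = 0.
  under eq_bigr do rewrite wE.
  rewrite big_split /= w_sum sumr_const card_ord -mulr_natr /m -/N.
  by field.
have -> : \sum_x (w + const_mx (- m)) x 0 ^+ 2 =
    1 + (d%:R - 1) * n%:R / N%:R * p ^+ 2.
  have sqE x : (w + const_mx (- m)) x 0 ^+ 2 = w x 0 ^+ 2 + (- 2 * m * w x 0 + m ^+ 2).
    by rewrite wE; ring.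
  under eq_bigr do rewrite sqE.
  rewrite !big_split /= -mulr_sumr w_sum w_sum2 sumr_const card_ord -mulr_natr -/N.
  (* Centring subtracts $(d-1)^2p^2/N$ from $1+(d-1)p^2$; the factor $1-(d-1)/N$ that appears is
     $n/N$. *)
  have nE : n%:R = N%:R - (d%:R - 1) :> R by rewrite NE; ring.
  by rewrite nE /m; field.
by move=> /(_ erefl); rewrite ler_pdivlMr // mulrC.
Qed.
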